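(* Let $E$ be a $\sigma$-Dedekind complete Banach lattice (over $\mathbb{C}$). Then the following conditions are equivalent: (1) $E$ is a Brezis--Lieb space; (2) $E$ is a $\sigma$-Brezis--Lieb space; (3) $E$ has the Brezis--Lieb property, and the norm in $E$ is order continuous.
   Context: Complex normed lattices. A vector space $E$ over $\mathbb{C}$ is a normed lattice if it is the complexification $E=F\oplus iF$ of a uniformly complete real normed lattice $F$. The modulus of $z=x+iy\in E$ (with $x,y\in F$) is $|z|=\sup_{\theta\in[0,2\pi)}[x\cos\theta+y\sin\theta]\in F_+$, and the norm is $\|z\|=\|z\|_E:=\|\,|z|\,\|_F$. One writes $E_+=F_+$. $E$ is a Banach lattice if it is norm complete. Order-theoretic notions for $E$ are those of the real part $F$: $E$ is $\sigma$-Dedekind complete if every nonempty countable subset of $F$ that is bounded above in $F$ has a supremum in $F$; the norm is order continuous if $\|v_\alpha\|\to 0$ for every net $v_\alpha\downarrow 0$ in $F$. Order convergence. A net $(v_\alpha)$ in $F$ converges in order to $v\in F$ if there is a net $(y_\beta)$ in $F$ (possibly over a different index set) with $y_\beta\downarrow 0$ such that for every $\beta$ there is $\alpha_0$ with $|v_\alpha-v|\le y_\beta$ for all $\alpha\ge\alpha_0$. Unbounded order ($uo$-) convergence. A net $v_\alpha$ in $E$ is $uo$-convergent to $v\in E$ if, for every $u\in E_+$, the net $|v_\alpha-v|\wedge u$ converges in order to $0$. Brezis--Lieb spaces. A normed lattice $(E,\|\cdot\|)$ is a Brezis--Lieb space (resp. $\sigma$-Brezis--Lieb space) if, for any net $x_\alpha$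 (resp. any sequence $x_n$) in $E$ and any $x_0\in E$ such that $\|x_\alpha\|\to\|x_0\|$ (resp. $\|x_n\|\to\|x_0\|$) and $x_\alpha$ (resp. $x_n$) is $uo$-convergent to $x_0$, one has $\|x_\alpha-x_0\|\to0$ (resp. $\|x_n-x_0\|\to 0$). Brezis--Lieb property. A normed lattice $(E,\|\cdot\|)$ has the Brezis--Lieb property if $\limsup_{n\to\infty}\|u_0+u_n\|>\|u_0\|$ for every disjoint normalized sequence $(u_n)_{n=1}^\infty$ in $E_+$ (that is, $u_n\wedge u_m=0$ for $n\neq m$ and $\|u_n\|=1$ for all $n\ge 1$) and every $u_0\in E_+$ ($u_0$ is not required to be disjoint from the $u_n$). *)

(* Defs.v *)
From HB Require Import structures.
From mathcomp Require Import all_boot all_order all_algebra complex.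
From mathcomp Require Import all_classical all_reals all_analysis.

Set Implicit Arguments.
Unset Strict Implicit.
Unset Printing Implicit Defensive.

Import Order.TTheory GRing.Theory Num.Theory.
Import numFieldNormedType.Exports.

Local Open Scope classical_set_scope.
Local Open Scope ring_scope.

Record directedType := DirectedType {
  dir_sort :> Type;
  dir_le : dir_sort -> dir_sort -> Prop;
  dir_inhabited : inhabited dir_sort;
  dir_refl : forall i, dir_le i i;
  dir_trans : forall j i k, dir_le i j -> dir_le j k -> dir_le i k;
  dir_ub : forall i j, exists k, dir_le i k /\ dir_le j k }.

Fact nat_dir_trans (j i k : nat) : (i <= j)%N -> (j <= k)%N -> (i <= k)%N.
Proof. exact: leq_trans. Qed.

Fact nat_dir_ub (i j : nat) : exists k, (i <= k)%N /\ (j <= k)%N.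
Proof. by exists (maxn i j); rewrite leq_maxl leq_maxr. Qed.

(* Sequences are the nets indexed by this directed set. *)
Definition nat_directed : directedType :=
  @DirectedType nat (fun i j => (i <= j)%N) (inhabits 0%N) leqnn
    nat_dir_trans nat_dir_ub.

Definition tails (I : directedType) : set_system I :=
  [set A | exists i0, forall i, dir_le i0 i -> A i].
Arguments tails : clear implicits.

Global Instance tails_proper_filter (I : directedType) : ProperFilter (tails I).
Proof.
split.
  by move=> [i0 Hi0]; exact: Hi0 (dir_refl i0).
split.
- by have [i0] := dir_inhabited I; exists i0.
- move=> P Q [i Pi] [j Qj]; have [k [ik jk]] := dir_ub i j.
  by exists k => l kl; split; [apply: Pi|apply: Qj]; exact: dir_trans kl.
- by move=> P Q PQ [i Pi]; exists i => j ij; exact/PQ/Pi.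
Qed.

(* [Order.Lattice] and [normedModType] are not reused here: apart from ordered
   rings, the hierarchy has no common extension of them with an ordered
   [zmodType], and such a join cannot be added after the fact. *)
HB.mixin Record isVectorLattice (R : realType) F
    of GRing.Lmodule R F & Num.POrderedZmodule F := {
  vl_join : F -> F -> F;
  vl_meet : F -> F -> F;
  vl_leD2r : forall x y z : F, x <= y -> x + z <= y + z;
  vl_scale_ge0 : forall (a : R) (x : F), 0 <= a -> 0 <= x -> 0 <= a *: x;
  vl_leUx : forall x y z : F, (vl_join x y <= z) = (x <= z) && (y <= z);
  vl_lexI : forall x y z : F, (z <= vl_meet x y) = (z <= x) && (z <= y) }.

#[short(type="vectorLatticeType")]
HB.structure Definition VectorLattice (R : realType) :=
  { F of GRing.Lmodule R F & Num.POrderedZmodule F & isVectorLattice R F }.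

Definition modulus (R : realType) (F : vectorLatticeType R) (x : F) : F :=
  vl_join x (- x).

HB.mixin Record hasLatticeNorm (R : realType) F of VectorLattice R F := {
  lnorm : F -> R;
  lnorm_eq0 : forall x, lnorm x = 0 -> x = 0;
  lnormZ : forall (a : R) x, lnorm (a *: x) = `|a| * lnorm x;
  lnormD : forall x y, lnorm (x + y) <= lnorm x + lnorm y;
  lnorm_mono : forall x y, modulus x <= modulus y -> lnorm x <= lnorm y }.

#[short(type="normedLatticeType")]
HB.structure Definition NormedLattice (R : realType) :=
  { F of VectorLattice R F & hasLatticeNorm R F }.

(* The order-theoretic notions of the complex lattice F (+) iF are by
   definition those of its real part F. *)
Section RealLattice.
Variables (R : realType) (F : normedLatticeType R).

Definition uniformly_complete : Prop :=
  forall (u : F) (x : nat -> F), 0 <= u ->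
    (forall e : R, 0 < e -> exists N, forall m n, (N <= m)%N -> (N <= n)%N ->
       modulus (x m - x n) <= e *: u) ->
    exists l : F, forall e : R, 0 < e -> exists N, forall n, (N <= n)%N ->
       modulus (x n - l) <= e *: u.

Definition sigma_dedekind_complete : Prop :=
  forall A : set F, countable A -> has_sup A -> supremums A !=set0.

Definition decreases_to0 (I : directedType) (v : I -> F) : Prop :=
  (forall i j, dir_le i j -> v j <= v i) /\ infimums (range v) 0.

Definition order_continuous_norm : Prop :=
  forall (I : directedType) (v : I -> F), decreases_to0 v ->
    (fun i => lnorm (v i)) @ tails I --> (0 : R).

Definition order_cvg (I : directedType) (v : I -> F) (l : F) : Prop :=
  exists (J : directedType) (y : J -> F), decreases_to0 y /\
    forall j, exists i0, forall i, dir_le i0 i -> modulus (v i - l) <= y j.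

End RealLattice.

Record complexification (R : realType) (F : normedLatticeType R) :=
  Cplx { re : F; im : F }.

Section Complexification.
Variables (R : realType) (F : normedLatticeType R).
Local Notation E := (complexification F).

Definition pair_of_cplx (z : E) : F * F := (re z, im z).
Definition cplx_of_pair (p : F * F) : E := Cplx p.1 p.2.
Fact cplx_eq (z w : E) : re z = re w -> im z = im w -> z = w.
Proof. by case: z w => [a b] [c d] /= -> ->. Qed.
Fact pair_of_cplxK : cancel pair_of_cplx cplx_of_pair.
Proof. by case. Qed.
HB.instance Definition _ := Choice.copy E (can_type pair_of_cplxK).

Definition cplx_add (z w : E) : E := Cplx (re z + re w) (im z + im w).
Definition cplx_opp (z : E) : E := Cplx (- re z) (- im z).
Fact cplx_addA : associative cplx_add.
Proof. by move=> [a b] [c d] [e f]; rewrite /cplx_add /= !addrA. Qed.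
Fact cplx_addC : commutative cplx_add.
Proof.
by move=> [a b] [c d]; rewrite /cplx_add /= (addrC a) (addrC b).
Qed.
Fact cplx_add0 : left_id (Cplx 0 0) cplx_add.
Proof. by move=> [a b]; rewrite /cplx_add /= !add0r. Qed.
Fact cplx_addN : left_inverse (Cplx 0 0) cplx_opp cplx_add.
Proof. by move=> [a b]; rewrite /cplx_add /= !addNr. Qed.
HB.instance Definition _ :=
  GRing.isZmodule.Build E cplx_addA cplx_addC cplx_add0 cplx_addN.

Definition cplx_scale (c : R[i]) (z : E) : E :=
  Cplx (complex.Re c *: re z - complex.Im c *: im z)
       (complex.Re c *: im z + complex.Im c *: re z).
Fact cplx_scaleA (c d : R[i]) (z : E) :
  cplx_scale c (cplx_scale d z) = cplx_scale (c * d) z.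
Proof.
apply: cplx_eq; case: c d z => [a b] [c d] [x y] /=;
  rewrite !scalerDr ?scalerN !scalerA ?scalerBl ?scalerDl ?opprD -!addrA;
  by congr (_ + _); rewrite addrA addrC.
Qed.
Fact cplx_scale1 : left_id (1 : R[i]) cplx_scale.
Proof.
by move=> [x y]; rewrite /cplx_scale /= !scale1r !scale0r subr0 addr0.
Qed.
Fact cplx_scaleDr : right_distributive cplx_scale +%R.
Proof.
by move=> [a b] [x y] [z w]; apply: cplx_eq => /=;
  rewrite !scalerDr ?opprD addrACA.
Qed.
Fact cplx_scaleDl (z : E) : {morph cplx_scale^~ z : c d / c + d}.
Proof.
by move=> [a b] [c d]; apply: cplx_eq => /=;
  rewrite !scalerDl ?opprD addrACA.
Qed.
HB.instance Definition _ :=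
  GRing.Zmodule_isLmodule.Build R[i] E
    cplx_scaleA cplx_scale1 cplx_scaleDr cplx_scaleDl.

(* Uniform completeness of [F] guarantees that this supremum exists, so the
   default value 0 of [supremum] plays no role. *)
Definition cmodulus (z : E) : F :=
  supremum 0 [set cos t *: re z + sin t *: im z | t in `[0, 2 * pi[%classic].

Definition cnorm (z : E) : R := lnorm (cmodulus z).

Definition of_real (x : F) : E := Cplx x 0.

End Complexification.

Section BrezisLieb.
Variables (R : realType) (F : normedLatticeType R).
Local Notation E := (complexification F).

(* Completeness of [F (+) iF] for [cnorm]. *)
Definition complexification_complete : Prop :=
  forall z : nat -> E,
    (forall e : R, 0 < e -> exists N, forall m n, (N <= m)%N -> (N <= n)%N ->
       cnorm (z m - z n) < e) ->
    exists l : E, (fun n => cnorm (z n - l)) @ \oo --> (0 : R).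

(* The positive cone of [F (+) iF] is that of [F]. *)
Definition uo_cvg (I : directedType) (v : I -> E) (l : E) : Prop :=
  forall u : F, 0 <= u ->
    order_cvg (fun i => vl_meet (cmodulus (v i - l)) u) 0.

Definition brezis_lieb_space : Prop :=
  forall (I : directedType) (x : I -> E) (x0 : E),
    (fun i => cnorm (x i)) @ tails I --> cnorm x0 ->
    uo_cvg x x0 ->
    (fun i => cnorm (x i - x0)) @ tails I --> (0 : R).

Definition sigma_brezis_lieb_space : Prop :=
  forall (x : nat -> E) (x0 : E),
    (fun n => cnorm (x n)) @ \oo --> cnorm x0 ->
    @uo_cvg nat_directed x x0 ->
    (fun n => cnorm (x n - x0)) @ \oo --> (0 : R).

Definition brezis_lieb_property : Prop :=
  forall (u : nat -> F) (u0 : F),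
    0 <= u0 ->
    (forall n, 0 <= u n) ->
    (forall n m, n <> m -> vl_meet (u n) (u m) = 0) ->
    (forall n, cnorm (of_real (u n)) = 1) ->
    ((cnorm (of_real u0))%:E
       < limn_esup (fun n => (cnorm (of_real (u0 + u n)))%:E))%E.

End BrezisLieb.

Arguments uniformly_complete {R} F.
Arguments sigma_dedekind_complete {R} F.
Arguments order_continuous_norm {R} F.
Arguments complexification_complete {R} F.
Arguments brezis_lieb_space {R} F.
Arguments sigma_brezis_lieb_space {R} F.
Arguments brezis_lieb_property {R} F.

(* Main.v *)
(* The two nontrivial implications go through disjoint sequences.

   If the norm is not order continuous, some order bounded disjoint sequence d
   in [0, x] stays away from 0 in norm: a decreasing net v with infimum 0 that
   is not norm null cannot be Cauchy, hence contains a decreasing sequence with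
   norm gaps, and the components of x in the bands where that sequence exceeds
   delta x again have norm gaps, so that their differences form d.  Then
   x - d_(2n) + k_n d_(2n+1), with k_n chosen so that the norm is that of x,
   is uo-convergent but not norm convergent to x.

   Conversely, put w_i = |x_i - x_0|.  Since |x_0| + |z| exceeds |x_0 + z| by
   at most 2 (|x_0| meet |z|), the norms of |x_0| + w_i tend to that of x_0,
   and order continuity makes w_i meet u norm null for every u.  If w_i is not
   norm null, one extracts a sequence that is within a norm null error of a
   disjoint one, which contradicts the Brezis-Lieb property. *)
Require Import Defs.
From mathcomp Require Import all_boot all_order all_algebra.
From mathcomp Require Import all_classical all_reals all_analysis.
From mathcomp Require Import lra.

Set Implicit Arguments.
Unset Strict Implicit.
Unset Printing Implicit Defensive.

Import Order.TTheory GRing.Theory Num.Theory.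
Import numFieldNormedType.Exports.

Local Open Scope classical_set_scope.
Local Open Scope ring_scope.

(** * Elementary order and disjointness calculus in vector lattices *)

Section VectorLatticeTheory.
Variables (R : realType) (F : vectorLatticeType R).
Implicit Types (x y z a b c : F) (k : R).

Definition vl_pos x : F := vl_join x 0.

Lemma vl_leD2rE z x y : (x + z <= y + z) = (x <= y).
Proof.
apply/idP/idP; last exact: vl_leD2r.
by move=> /(@vl_leD2r _ _ _ _ (- z)); rewrite !addrK.
Qed.

Lemma vl_leD2lE z x y : (z + x <= z + y) = (x <= y).
Proof. by rewrite ![z + _]addrC vl_leD2rE. Qed.

Lemma vl_leD x y z a : x <= y -> z <= a -> x + z <= y + a.
Proof.
by move=> xy za; apply: (@le_trans _ _ (y + z)); rewrite ?vl_leD2rE ?vl_leD2lE.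
Qed.

Lemma vl_subr_ge0 x y : (0 <= y - x) = (x <= y).
Proof. by rewrite -[LHS](vl_leD2rE x) add0r subrK. Qed.

Lemma vl_leBlDr x y z : (x - y <= z) = (x <= z + y).
Proof. by rewrite -[LHS](vl_leD2rE y) subrK. Qed.

Lemma vl_leBrDr x y z : (x <= y - z) = (x + z <= y).
Proof. by rewrite -[LHS](vl_leD2rE z) subrK. Qed.

Lemma vl_leN2 x y : (- x <= - y) = (y <= x).
Proof. by rewrite -[LHS]vl_subr_ge0 opprK addrC vl_subr_ge0. Qed.

Lemma vl_addr_ge0 x y : 0 <= x -> 0 <= y -> 0 <= x + y.
Proof. by move=> x0 y0; rewrite -[0]addr0; exact: vl_leD. Qed.

Lemma vl_lerDl x y : 0 <= y -> x <= x + y.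
Proof. by move=> y0; rewrite -{1}[x]addr0 vl_leD2lE. Qed.

Lemma vl_lerBl x y : 0 <= y -> x - y <= x.
Proof. by move=> y0; rewrite vl_leBlDr vl_lerDl. Qed.

Lemma vl_scale_le k x y : 0 <= k -> x <= y -> k *: x <= k *: y.
Proof.
by move=> k0 xy; rewrite -vl_subr_ge0 -scalerBr vl_scale_ge0 // vl_subr_ge0.
Qed.

Lemma vl_scale_lel k (l : R) x : 0 <= x -> k <= l -> k *: x <= l *: x.
Proof.
by move=> x0 kl; rewrite -vl_subr_ge0 -scalerBl vl_scale_ge0 // subr_ge0.
Qed.

Lemma vl_joinl x y : x <= vl_join x y.
Proof. by have := lexx (vl_join x y); rewrite vl_leUx => /andP[]. Qed.

Lemma vl_joinr x y : y <= vl_join x y.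
Proof. by have := lexx (vl_join x y); rewrite vl_leUx => /andP[]. Qed.

Lemma vl_meetl x y : vl_meet x y <= x.
Proof. by have := lexx (vl_meet x y); rewrite vl_lexI => /andP[]. Qed.

Lemma vl_meetr x y : vl_meet x y <= y.
Proof. by have := lexx (vl_meet x y); rewrite vl_lexI => /andP[]. Qed.

Lemma vl_joinC x y : vl_join x y = vl_join y x.
Proof. by apply/eqP; rewrite eq_le !vl_leUx !vl_joinl !vl_joinr. Qed.

Lemma vl_meetC x y : vl_meet x y = vl_meet y x.
Proof. by apply/eqP; rewrite eq_le !vl_lexI !vl_meetl !vl_meetr. Qed.

Lemma vl_meet_le x y a b : x <= a -> y <= b -> vl_meet x y <= vl_meet a b.
Proof.
move=> xa yb; rewrite vl_lexI (le_trans (vl_meetl _ _) xa).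
by rewrite (le_trans (vl_meetr _ _) yb).
Qed.

Lemma vl_join_le x y a b : x <= a -> y <= b -> vl_join x y <= vl_join a b.
Proof.
move=> xa yb; rewrite vl_leUx (le_trans xa (vl_joinl _ _)).
by rewrite (le_trans yb (vl_joinr _ _)).
Qed.

Lemma vl_meet_ge0 x y : 0 <= x -> 0 <= y -> 0 <= vl_meet x y.
Proof. by move=> x0 y0; rewrite vl_lexI x0. Qed.

Lemma vl_meet_idPl x y : x <= y -> vl_meet x y = x.
Proof. by move=> xy; apply/eqP; rewrite eq_le vl_meetl vl_lexI lexx. Qed.

Lemma vl_joinDr x y z : vl_join (x + z) (y + z) = vl_join x y + z.
Proof.
apply/eqP; rewrite eq_le vl_leUx !vl_leD2rE vl_joinl vl_joinr /=.
by rewrite -vl_leBrDr vl_leUx !vl_leBrDr vl_joinl vl_joinr.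
Qed.

Lemma vl_joinN x y : vl_join (- x) (- y) = - vl_meet x y.
Proof.
apply/eqP; rewrite eq_le vl_leUx !vl_leN2 vl_meetl vl_meetr /=.
rewrite -[leRHS]opprK vl_leN2 vl_lexI.
by rewrite -vl_leN2 opprK vl_joinl -vl_leN2 opprK vl_joinr.
Qed.

Lemma vl_meetDr x y z : vl_meet (x + z) (y + z) = vl_meet x y + z.
Proof. by apply: oppr_inj; rewrite -vl_joinN !opprD vl_joinDr vl_joinN. Qed.

Lemma vl_joinD_meet x y : vl_join x y + vl_meet x y = x + y.
Proof.
(* Negation turns the meet into a join, and translation by [x + y] carries [- x] and [- y] to [y]
   and [x]. *)
have -> : vl_meet x y = x + y - vl_join x y.
  rewrite -[LHS]opprK -vl_joinN.
  have -> : - x = y - (x + y) by rewrite opprD addrCA subrr addr0.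
  have -> : - y = x - (x + y) by rewrite opprD addrA subrr sub0r.
  by rewrite vl_joinDr opprB vl_joinC.
by rewrite addrC subrK.
Qed.

Lemma vl_scale_meet k x y :
  0 < k -> k *: vl_meet x y = vl_meet (k *: x) (k *: y).
Proof.
have le_meet (l : R) a b : 0 < l ->
    l *: vl_meet a b <= vl_meet (l *: a) (l *: b).
  by move=> /ltW l0; rewrite vl_lexI !vl_scale_le ?vl_meetl ?vl_meetr.
move=> k0; apply/le_anti; rewrite le_meet//=.
have ki0 : 0 < k^-1 by rewrite invr_gt0.
rewrite -[leLHS](scalerKV (lt0r_neq0 k0)) vl_scale_le ?(ltW k0)//.
by rewrite (le_trans (le_meet _ _ _ ki0))// !scalerK ?lt0r_neq0.
Qed.

Lemma vl_pos_ge0 x : 0 <= vl_pos x. Proof. exact: vl_joinr. Qed.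

Lemma vl_le_pos x : x <= vl_pos x. Proof. exact: vl_joinl. Qed.

Lemma vl_pos_le x y : x <= y -> vl_pos x <= vl_pos y.
Proof. by move=> xy; apply: vl_join_le. Qed.

Lemma vl_pos_lub x y : x <= y -> 0 <= y -> vl_pos x <= y.
Proof. by move=> xy y0; rewrite vl_leUx xy. Qed.

Lemma vl_posB x a : vl_pos (x - a) = x - vl_meet x a.
Proof.
rewrite /vl_pos -[0](subrr a) vl_joinDr; apply/eqP.
by rewrite subr_eq addrAC eq_sym subr_eq vl_joinD_meet.
Qed.

Lemma vl_pos_disjoint x y : vl_meet (vl_pos (x - y)) (vl_pos (y - x)) = 0.
Proof.
by rewrite !vl_posB (vl_meetC y x) vl_meetDr subrr.
Qed.

Lemma vl_disjoint_le a b x y : 0 <= a -> 0 <= b -> a <= x -> b <= y ->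
  vl_meet x y = 0 -> vl_meet a b = 0.
Proof.
move=> a0 b0 ax bY xy; apply/eqP; rewrite eq_le vl_meet_ge0// andbT.
by rewrite -xy vl_meet_le.
Qed.

(** With [t] the left side, [t - x] lies below both [y] and [z]; hence [t - vl_meet y z] lies below
    [x], and below [z] since the subtracted meet is positive. *)
Lemma vl_meetD_le x y z : 0 <= x -> 0 <= y -> 0 <= z ->
  vl_meet (x + y) z <= vl_meet x z + vl_meet y z.
Proof.
move=> x0 y0 z0; set t := vl_meet _ z.
have tx : t - x <= vl_meet y z.
  rewrite vl_lexI vl_leBlDr addrC vl_meetl vl_leBlDr.
  by rewrite (le_trans (vl_meetr _ _))// vl_lerDl.
rewrite -vl_leBlDr vl_lexI !vl_leBlDr.
rewrite vl_leBlDr addrC in tx; rewrite tx/=.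
by rewrite (le_trans (vl_meetr _ _))// vl_lerDl// vl_meet_ge0.
Qed.

Lemma vl_disjointD a b c : 0 <= a -> 0 <= b -> 0 <= c ->
  vl_meet a c = 0 -> vl_meet b c = 0 -> vl_meet (a + b) c = 0.
Proof.
move=> a0 b0 c0 ac bc; apply/eqP.
rewrite eq_le vl_meet_ge0 ?vl_addr_ge0// andbT.
by rewrite (le_trans (vl_meetD_le _ _ _))// ac bc addr0.
Qed.

Lemma vl_disjointZ k a b : 0 <= k -> 0 <= a -> 0 <= b ->
  vl_meet a b = 0 -> vl_meet (k *: a) b = 0.
Proof.
move=> k0 a0 b0 ab; have k1 : 0 < k + 1 by rewrite ltr_wpDl.
(* The factor [k + 1] is positive even for [k = 0] and makes the multiples dominate both [k *: a]
   and [b]. *)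
apply: (@vl_disjoint_le _ _ ((k + 1) *: a) ((k + 1) *: b)) => //.
- exact: vl_scale_ge0.
- by apply: vl_scale_lel; rewrite ?lerDl.
- by rewrite -{1}[b]scale1r vl_scale_lel// lerDr.
- by rewrite -vl_scale_meet// ab scaler0.
Qed.

(** For [a] in [A], disjointness turns the sum of [a] and [vl_meet z s] into their join, which is at
    most [s]. So [s - vl_meet z s] also bounds [A], which forces the meet to vanish. *)
Lemma vl_disjoint_sup z (A : set F) s : 0 <= z -> 0 <= s ->
  supremums A s -> (forall a, A a -> 0 <= a) ->
  (forall a, A a -> vl_meet z a = 0) -> vl_meet z s = 0.
Proof.
move=> z0 s0 [ubs lubs] A0 zA; apply/eqP.
rewrite eq_le vl_meet_ge0// andbT -[_ <= 0]vl_leN2 oppr0.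
have : s <= s - vl_meet z s.
  apply: lubs => a Aa; rewrite vl_leBrDr -vl_joinD_meet.
  have -> : vl_meet a (vl_meet z s) = 0.
    apply: (@vl_disjoint_le _ _ a z); rewrite ?vl_meet_ge0 ?vl_meetl//.
    - exact: A0.
    - by rewrite vl_meetC zA.
  by rewrite addr0 vl_leUx ubs// vl_meetr.
by rewrite -vl_subr_ge0 addrAC subrr sub0r.
Qed.

Lemma vl_le_modulus x : x <= modulus x. Proof. exact: vl_joinl. Qed.

Lemma vl_leN_modulus x : - x <= modulus x. Proof. exact: vl_joinr. Qed.

Lemma vl_modulusN x : modulus (- x) = modulus x.
Proof. by rewrite /modulus opprK vl_joinC. Qed.

Lemma vl_ge0_double x : 0 <= x + x -> 0 <= x.
Proof.
move=> x0; have -> : x = 2^-1 *: (x + x).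
  rewrite -[x + x]mulr2n -[x *+ 2]scaler_nat scalerA.
  by rewrite mulVf ?scale1r// pnatr_eq0.
by rewrite vl_scale_ge0 ?invr_ge0.
Qed.

Lemma vl_modulus_ge0 x : 0 <= modulus x.
Proof.
apply: vl_ge0_double; rewrite -[0](subrr x).
by apply: vl_leD; [exact: vl_le_modulus|exact: vl_leN_modulus].
Qed.

Lemma vl_ger0_modulus x : 0 <= x -> modulus x = x.
Proof.
move=> x0; apply/eqP; rewrite eq_le vl_le_modulus vl_leUx lexx/= andbT.
by rewrite -vl_subr_ge0 opprK vl_addr_ge0.
Qed.

Lemma vl_modulus_leP x y : (modulus x <= y) = (x <= y) && (- x <= y).
Proof. exact: vl_leUx. Qed.

Lemma vl_scale_le_modulus k x : k *: x <= `|k| *: modulus x.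
Proof.
have [k0|k0] := leP 0 k.
  by rewrite ger0_norm// vl_scale_le// vl_le_modulus.
rewrite ltr0_norm// -[k *: x]opprK -scaleNr -scalerN.
by rewrite vl_scale_le ?vl_leN_modulus// oppr_ge0 ltW.
Qed.

End VectorLatticeTheory.

(** * Lattice norms and the Archimedean property *)

Section LatticeNorm.
Variables (R : realType) (F : normedLatticeType R).
Implicit Types (x y z u : F).

Lemma lnorm0 : lnorm (0 : F) = 0.
Proof. by rewrite -(scale0r (0 : F)) lnormZ normr0 mul0r. Qed.

Lemma lnormN x : lnorm (- x) = lnorm x.
Proof. by rewrite -scaleN1r lnormZ normrN1 mul1r. Qed.

Lemma lnormB x y : lnorm (x - y) <= lnorm x + lnorm y.
Proof. by rewrite -[lnorm y]lnormN lnormD. Qed.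

Lemma lnorm_ge0 x : 0 <= lnorm x.
Proof. by have := lnormB x x; rewrite subrr lnorm0 -mulr2n pmulrn_lge0. Qed.

Lemma lnorm_le x y : 0 <= x -> x <= y -> lnorm x <= lnorm y.
Proof.
move=> x0 xy; apply: lnorm_mono.
by rewrite !vl_ger0_modulus// (le_trans x0).
Qed.

Lemma lnorm_modulus x : lnorm (modulus x) = lnorm x.
Proof.
by apply/le_anti/andP; split; apply: lnorm_mono;
  rewrite (vl_ger0_modulus (vl_modulus_ge0 _)).
Qed.

Lemma lnorm_modulus_le x y : modulus x <= y -> lnorm x <= lnorm y.
Proof.
by move=> xy; rewrite -lnorm_modulus lnorm_le// vl_modulus_ge0.
Qed.

Lemma lnorm_pos_le x : lnorm (vl_pos x) <= lnorm x.
Proof.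
rewrite -(lnorm_modulus x) lnorm_le ?vl_pos_ge0//.
by rewrite vl_pos_lub ?vl_le_modulus ?vl_modulus_ge0.
Qed.

Lemma lnorm_small0 x : (forall e, 0 < e -> lnorm x <= e) -> x = 0.
Proof.
move=> xe; apply: lnorm_eq0; apply/le_anti; rewrite lnorm_ge0 andbT.
by apply/ler_addgt0Pl => e e0; rewrite addr0 xe.
Qed.

(** This carries order inequalities over to norm limits. *)
Lemma pos_small_le0 x : (forall e, 0 < e -> lnorm (vl_pos x) <= e) -> x <= 0.
Proof. by move=> /lnorm_small0 <-; exact: vl_le_pos. Qed.

Lemma nlattice_archi x y u :
  0 <= u -> (forall e : R, 0 < e -> x <= y + e *: u) -> x <= y.
Proof.
move=> u0 xyu; rewrite -[_ <= _](vl_leD2rE (- y)) subrr.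
apply: pos_small_le0 => e e0.
(* Adding 1 keeps the divisor positive when [u = 0]. *)
have l0 : 0 < lnorm u + 1 by rewrite ltr_wpDl ?lnorm_ge0.
have d0 : 0 < e / (lnorm u + 1) by rewrite divr_gt0.
apply: (@le_trans _ _ (lnorm ((e / (lnorm u + 1)) *: u))).
  apply: lnorm_le; rewrite ?vl_pos_ge0// vl_pos_lub ?vl_scale_ge0 ?(ltW d0)//.
  by rewrite vl_leBlDr addrC xyu.
rewrite lnormZ (ger0_norm (ltW d0)) mulrAC ler_pdivrMr// ler_pM2l// lerDl.
exact: ler01.
Qed.

End LatticeNorm.

(** * Countable suprema and the complex modulus *)

Section SigmaDedekind.
Variables (R : realType) (F : normedLatticeType R).
Hypothesis F_sigma : sigma_dedekind_complete F.
Implicit Types (x y z u : F).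

Lemma countable_supremum (A : set F) u : countable A -> A !=set0 ->
  ubound A u -> exists s, supremums A s.
Proof. by move=> cA A0 Au; apply: F_sigma => //; split => //; exists u. Qed.

Lemma seq_supremum (v : nat -> F) u :
  (forall n, v n <= u) -> exists s, supremums (range v) s.
Proof.
move=> vu; apply: (@countable_supremum _ u).
- exact: card_le_trans (card_image_le _ _) (countableP _).
- by exists (v 0%N), 0%N.
- by move=> _ [n _ <-].
Qed.

Local Notation circle x y :=
  [set cos t *: x + sin t *: y | t in `[0, 2 * pi[%classic].

Lemma circle_le x y (t : R) :
  cos t *: x + sin t *: y <= modulus x + modulus y.
Proof.
have le_mod (k : R) a : `|k| <= 1 -> k *: a <= modulus a.
  move=> k1; rewrite (le_trans (vl_scale_le_modulus _ _))//.
  by rewrite -[leRHS]scale1r vl_scale_lel// vl_modulus_ge0.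
by apply: vl_leD; apply: le_mod; [exact: cos_max|exact: sin_max].
Qed.

(** Rational angles reduce the supremum defining the modulus to a countable one. The rational is
    taken just to the right of [t], so that it stays in the half-open interval. *)
Lemma near_rat_angle (t e : R) : t \in `[0, 2 * pi[ -> 0 < e ->
  exists q : rat, [/\ (ratr q : R) \in `[0, 2 * pi[,
    `|cos t - cos (ratr q)| <= e & `|sin t - sin (ratr q)| <= e].
Proof.
rewrite in_itv/= => /andP[t0 tpi] e0.
have [d /= d0 hc] := (cvgrPdist_le _ _).1 (@continuous_cos R t) e e0.
have [d' /= d'0 hs] := (cvgrPdist_le _ _).1 (@continuous_sin R t) e e0.
have tm : t < Num.min (2 * pi) (t + Num.min d d').
  by rewrite lt_min tpi ltrDl lt_min d0 d'0.
have [q] := rat_in_itvoo tm.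
rewrite in_itv/= !lt_min => /andP[tq /andP[qpi qd]].
rewrite -ltrBlDl lt_min in qd; move: qd => /andP[qd qd'].
exists q; split; first by rewrite in_itv/= qpi (ltW (le_lt_trans t0 tq)).
- by apply: hc; rewrite /= distrC gtr0_norm// subr_gt0.
- by apply: hs; rewrite /= distrC gtr0_norm// subr_gt0.
Qed.

(** The supremum over rational angles exists by countability. It bounds the other angles as well:
    moving to a nearby rational angle costs at most a small multiple of [modulus x + modulus y], and
    [F] is Archimedean. *)
Lemma circle_supremum x y : exists s, supremums (circle x y) s.
Proof.
pose f (t : R) := cos t *: x + sin t *: y.
have [s [ubs lubs]] : exists s, supremums
    [set f (ratr q) | q in [set q : rat | (ratr q : R) \in `[0, 2 * pi[]] s.
  apply: (@countable_supremum _ (modulus x + modulus y)).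
  - exact: card_le_trans (card_image_le _ _) (countableP _).
  - exists (f (ratr 0)), 0 => //=.
    by rewrite rmorph0 in_itv/= lexx mulr_gt0// pi_gt0.
  - by move=> _ [q _ <-]; exact: circle_le.
exists s; split; last first.
  by move=> b bS; apply: lubs => _ [q /= qI <-]; apply: bS; exists (ratr q).
move=> _ [t tI <-]; apply: (@nlattice_archi _ _ _ _ (modulus x + modulus y)).
  by rewrite vl_addr_ge0 ?vl_modulus_ge0.
move=> e e0; have [q [qI ct st]] := near_rat_angle tI e0.
have -> : cos t *: x + sin t *: y = f (ratr q) +
   ((cos t - cos (ratr q)) *: x + (sin t - sin (ratr q)) *: y).
  by rewrite [RHS]addrACA !scalerBl !subrKC.
apply: vl_leD; first by apply: ubs; exists q.
rewrite scalerDr; apply: vl_leD;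
  (apply: le_trans; first exact: vl_scale_le_modulus);
  by rewrite vl_scale_lel ?vl_modulus_ge0.
Qed.

Lemma cmodulus_sup (z : complexification F) :
  supremums (circle (re z) (im z)) (cmodulus z).
Proof.
have [s ss] := circle_supremum (re z) (im z).
(* The default value 0 would require an empty set, but the angle 0 contributes [re z]. *)
rewrite /cmodulus /supremum; case: ifPn => [/eqP S0|_].
  exfalso; suff : circle (re z) (im z) (re z) by rewrite S0.
  exists 0; last by rewrite cos0 sin0 scale1r scale0r addr0.
  by rewrite /= in_itv/= lexx mulr_gt0// pi_gt0.
by case: xgetP => [//|/(_ s)].
Qed.

Lemma cmodulus_ub (z : complexification F) (t : R) : 0 <= t < 2 * pi ->
  cos t *: re z + sin t *: im z <= cmodulus z.
Proof. by move=> ?; apply: (cmodulus_sup z).1; exists t; rewrite //= in_itv. Qed.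

Lemma cmodulus_le (z : complexification F) u :
  (forall t : R, 0 <= t < 2 * pi -> cos t *: re z + sin t *: im z <= u) ->
  cmodulus z <= u.
Proof.
move=> zu; apply: (cmodulus_sup z).2 => _ [t + <-].
by rewrite /= in_itv/=; exact: zu.
Qed.

Lemma re_cmodulus (z : complexification F) : modulus (re z) <= cmodulus z.
Proof.
have pi0 := pi_gt0 R; rewrite vl_modulus_leP; apply/andP; split.
  have := @cmodulus_ub z 0; rewrite cos0 sin0 scale1r scale0r addr0; apply.
  by rewrite lexx mulr_gt0.
have := @cmodulus_ub z pi; rewrite cospi sinpi scaleN1r scale0r addr0; apply.
by rewrite ltW//= mulr_natl mulr2n ltrDl.
Qed.

Lemma cmodulus_ge0 (z : complexification F) : 0 <= cmodulus z.
Proof. exact: le_trans (vl_modulus_ge0 _) (re_cmodulus z). Qed.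

Lemma cmodulus_of_real x : cmodulus (of_real x) = modulus x.
Proof.
apply/le_anti; rewrite (re_cmodulus (of_real x)) andbT.
apply: cmodulus_le => t _ /=; have := circle_le x 0 t.
by rewrite (@vl_ger0_modulus _ _ 0)// addr0.
Qed.

Lemma cmodulusD (z w : complexification F) :
  cmodulus (z + w) <= cmodulus z + cmodulus w.
Proof.
apply: cmodulus_le => t tI /=; rewrite !scalerDr addrACA.
by apply: vl_leD; exact: cmodulus_ub.
Qed.

Lemma cmodulusN (z : complexification F) : cmodulus (- z) = cmodulus z.
Proof.
suff le_modN (w : complexification F) : cmodulus (- w) <= cmodulus w.
  by apply/le_anti; rewrite le_modN -{1}[z]opprK le_modN.
apply: cmodulus_le => t /andP[t0 tpi] /=.
(* Negation is rotation by [pi]; the angle is shifted up or down so as to remain in the interval. *)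
rewrite !scalerN -!scaleNr; have pi0 := pi_gt0 R; have [tp|pt] := ltP t pi.
  by rewrite -cosDpi -sinDpi; apply: cmodulus_ub; lra.
rewrite -{1 2}(subrK pi t) cosDpi sinDpi !opprK.
by apply: cmodulus_ub; lra.
Qed.

(** Each of the two moduli is at most [cmodulus (w + z)] plus either modulus, so their join is at
    most [cmodulus (w + z)] plus their meet. Adding the meet once more turns the join into the
    sum. *)
Lemma cmodulus_triangle (z w : complexification F) :
  cmodulus w + cmodulus z <=
    cmodulus (w + z) + vl_meet (cmodulus w) (cmodulus z) *+ 2.
Proof.
have zle : cmodulus z <= cmodulus (w + z) + cmodulus w.
  by rewrite -(cmodulusN w) (le_trans _ (cmodulusD _ _))// addrAC subrr add0r.
have wle : cmodulus w <= cmodulus (w + z) + cmodulus z.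
  by rewrite -(cmodulusN z) (le_trans _ (cmodulusD _ _))// addrK.
rewrite -vl_joinD_meet mulr2n addrA vl_leD2rE [leRHS]addrC -vl_meetDr.
rewrite vl_leUx !vl_lexI !vl_lerDl ?cmodulus_ge0//=.
by rewrite ![_ + cmodulus (_ + _)]addrC wle zle.
Qed.

Lemma cnorm_of_real x : cnorm (of_real x) = lnorm x.
Proof. by rewrite /cnorm cmodulus_of_real lnorm_modulus. Qed.

Lemma lnorm_re (z : complexification F) : lnorm (re z) <= cnorm z.
Proof. by rewrite lnorm_modulus_le// re_cmodulus. Qed.

Lemma cnorm_ge0 (z : complexification F) : 0 <= cnorm z.
Proof. exact: lnorm_ge0. Qed.

End SigmaDedekind.

(** * Convergence along directed sets *)

Lemma tails_nat : tails nat_directed = \oo :> set_system nat.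
Proof.
rewrite predeqE => A; split=> [[N NA]|[N _ NA]]; first by exists N.
by exists N.
Qed.

Lemma dir_le_homo (I : directedType) (a : nat -> I) :
  (forall n, dir_le (a n) (a n.+1)) ->
  forall m n, (m <= n)%N -> dir_le (a m) (a n).
Proof.
move=> an m n /subnK <-; elim: (n - m)%N => [|k IH]; first exact: dir_refl.
exact: dir_trans IH (an _).
Qed.

Section Nets.
Variables (R : realType) (I : directedType).

Lemma tails_cvgP (f : I -> R) (l : R) :
  f @ tails I --> l <->
  forall e, 0 < e -> exists i0, forall i, dir_le i0 i -> `|f i - l| <= e.
Proof.
split=> [/cvgrPdist_le fl e e0|fl].
  by have [i0 i0P] := fl e e0; exists i0 => i /i0P; rewrite distrC.
apply/cvgrPdist_le => e e0; have [i0 i0P] := fl e e0.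
by exists i0 => i /i0P; rewrite distrC.
Qed.

Lemma tails_cvg0P (f : I -> R) : (forall i, 0 <= f i) ->
  f @ tails I --> (0 : R) <->
  forall e, 0 < e -> exists i0, forall i, dir_le i0 i -> f i <= e.
Proof.
by move=> f0; rewrite tails_cvgP; split=> fc e /fc[i0 i0P];
  exists i0 => i /i0P; rewrite subr0 ger0_norm.
Qed.

End Nets.

(** * Norm gaps in decreasing nets, and uo-convergence from disjointness *)

Section BanachLattice.
Variables (R : realType) (F : normedLatticeType R).
Hypothesis F_sigma : sigma_dedekind_complete F.
Hypothesis E_banach : complexification_complete F.
Implicit Types (x y z u : F).

Lemma of_realB x y : of_real x - of_real y = of_real (x - y).
Proof. by apply: cplx_eq => //=; rewrite subr0. Qed.

(** Completeness passes from the complexification to [F]: the real part of the complex limit is a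
    limit, because taking real parts does not increase the norm. *)
Lemma lnorm_complete (v : nat -> F) :
  (forall e : R, 0 < e -> exists N, forall m n, (N <= m)%N -> (N <= n)%N ->
     lnorm (v m - v n) < e) ->
  exists l, forall e, 0 < e -> exists N, forall n, (N <= n)%N ->
    lnorm (v n - l) <= e.
Proof.
move=> vC; have [l vl] : exists l : complexification F,
    (fun n => cnorm (of_real (v n) - l)) @ \oo --> (0 : R).
  apply: E_banach => e /vC[N NP]; exists N => m n Nm Nn.
  by rewrite of_realB cnorm_of_real//; exact: NP.
exists (re l) => e e0; have [N _ NP] := (cvgrPdist_le _ _).1 vl e e0.
exists N => n /NP /=; rewrite sub0r normrN ger0_norm ?cnorm_ge0//.
exact/le_trans/(lnorm_re F_sigma (of_real (v n) - l)).
Qed.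

(** If no gap size recurs beyond every index, the net is Cauchy. A sequence of its values then
    converges in norm to a lower bound of the net, hence to some [l <= 0], and this makes the net
    norm null. *)
Lemma decreasing_net_gap (I : directedType) (v : I -> F) :
  decreases_to0 v -> ~ ((fun i => lnorm (v i)) @ tails I --> (0 : R)) ->
  exists (eta : R) (a : nat -> I), [/\ 0 < eta,
    forall m n, (m <= n)%N -> dir_le (a m) (a n) &
    forall n, eta <= lnorm (v (a n) - v (a n.+1))].
Proof.
move=> [v_dec [v_lb v_glb]] v_ncvg.
have v_ge0 i : 0 <= v i by apply: v_lb; exists i.
have [[eta [eta0 gap]]|no_gap] := pselect (exists eta : R, 0 < eta /\
    forall i, exists j, dir_le i j /\ eta <= lnorm (v i - v j)).
  have [g gP] := choice gap; have [i0] := dir_inhabited I.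
  exists eta, (fun n => iter n g i0); split=> //.
  - by apply: dir_le_homo => n; exact: (gP _).1.
  - by move=> n; exact: (gP _).2.
have small n : exists i, forall j, dir_le i j -> lnorm (v i - v j) < n.+1%:R^-1.
  apply: contrapT => /forallNP hn; apply: no_gap.
  exists n.+1%:R^-1; split=> [|i]; first by rewrite invr_gt0.
  have /existsNP[j /not_implyP[ij /negP]] := hn i.
  by rewrite -leNgt => nij; exists j.
have [h hP] := choice small.
have [ub ubP] : exists ub : I -> I -> I,
    forall i j, dir_le i (ub i j) /\ dir_le j (ub i j).
  have [f fP] := choice (fun p : I * I => dir_ub p.1 p.2).
  by exists (fun i j => f (i, j)) => i j; exact: fP (i, j).
(* The sequence [b] increases and dominates [h], so beyond [b n] the net stays within [n.+1%:R^-1]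
   of [v (b n)]. *)
pose b := fix b n := if n is m.+1 then ub (b m) (h m.+1) else h 0%N.
have b_mono : forall m n, (m <= n)%N -> dir_le (b m) (b n).
  by apply: dir_le_homo => n; exact: (ubP _ _).1.
have hb n : dir_le (h n) (b n).
  by case: n => [|n]; [exact: dir_refl|exact: (ubP _ _).2].
have bP n j : dir_le (b n) j -> lnorm (v (b n) - v j) <= n.+1%:R^-1.
  move=> bnj; apply: le_trans (ltW (hP n j (dir_trans (hb n) bnj))).
  by rewrite lnorm_le ?vl_subr_ge0 ?vl_leD2rE ?v_dec.
have [l lP] : exists l, forall e, 0 < e -> exists N, forall n, (N <= n)%N ->
    lnorm (v (b n) - l) <= e.
  apply: lnorm_complete => e e0.
  have [N Ne] : exists N : nat, N.+1%:R^-1 < e / 2.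
    exists (Num.bound (e / 2)^-1); rewrite invf_plt ?posrE ?divr_gt0//.
    rewrite (lt_le_trans (archi_boundP _)) ?invr_ge0 ?ler_nat//.
    by rewrite divr_ge0 ?ltW.
  exists N => m n Nm Nn.
  have -> : v (b m) - v (b n) = (v (b N) - v (b n)) - (v (b N) - v (b m)).
    by rewrite opprB [RHS]addrC addrA subrK.
  move: (bP N _ (b_mono _ _ Nm)) (bP N _ (b_mono _ _ Nn)) Ne.
  move: (lnormB (v (b N) - v (b n)) (v (b N) - v (b m))).
  by move: (lnorm _) (lnorm _) (lnorm _) N.+1%:R^-1 => *; lra.
exfalso; apply: v_ncvg; apply/tails_cvg0P => [i|e e0]; first exact: lnorm_ge0.
(* For late [i], [v i <= v (b N) <= v (b N) - l], and the last term is small in norm. *)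
suff l0 : l <= 0.
  have [N NP] := lP e e0; exists (b N) => i bi.
  apply: le_trans (NP N (leqnn N)).
  rewrite lnorm_le// (le_trans (v_dec _ _ bi))// vl_lerDl//.
  by rewrite -oppr0 vl_leN2.
(* To see that [l] is a lower bound, [v i] is replaced by a smaller [v j] with [j] beyond both [i]
   and [b n]; there [v j] is close to [v (b n)], hence to [l]. *)
apply: v_glb => _ [i _ <-]; rewrite -[_ <= _](vl_leD2rE (- v i)) subrr.
apply: pos_small_le0 => d d0.
have d20 : 0 < d / 2 by rewrite divr_gt0.
have [N NP] := lP _ d20; pose n := maxn N (Num.bound (d / 2)^-1).
have nd : n.+1%:R^-1 <= d / 2.
  rewrite invf_ple ?posrE//; apply: ltW.
  rewrite (lt_le_trans (archi_boundP _)) ?invr_ge0 ?(ltW d20)// ler_nat.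
  by rewrite leqW// leq_maxr.
have [j [ij bj]] := dir_ub i (b n).
apply: (@le_trans _ _ (lnorm (vl_pos (l - v j)))).
  by rewrite lnorm_le ?vl_pos_ge0// vl_pos_le// vl_leD2lE vl_leN2 v_dec.
apply: le_trans (lnorm_pos_le _) _.
have -> : l - v j = (v (b n) - v j) - (v (b n) - l).
  by rewrite opprB [RHS]addrC addrA subrK.
move: (NP n (leq_maxl _ _)) (bP n j bj) nd.
move: (lnormB (v (b n) - v j) (v (b n) - l)).
by move: (lnorm _) (lnorm _) (lnorm _) n.+1%:R^-1 => *; lra.
Qed.

Lemma seq_infimum (v : nat -> F) u :
  (forall n, u <= v n) -> exists s, infimums (range v) s.
Proof.
move=> uv.
have [|s [ubs lubs]] := @seq_supremum _ _ F_sigma (fun n => - v n) (- u).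
  by move=> n; rewrite vl_leN2.
exists (- s); split=> [_ [n _ <-]|b bv].
  by rewrite -vl_leN2 opprK; apply: ubs; exists n.
rewrite -vl_leN2 opprK; apply: lubs => _ [n _ <-].
by rewrite vl_leN2; apply: bv; exists n.
Qed.

(** The dominating sequence [y n] is the supremum of the truncations of [h] from index [n] on. The
    positive part [c] of a lower bound lies below every [y k.+1], so it is disjoint from every [h k]
    and therefore from [y 0]. As [c] also lies below [y 0], it vanishes. *)
Lemma disjoint_uo_cvg (z : nat -> complexification F) l (h : nat -> F) :
  (forall n, 0 <= h n) -> (forall m n, m <> n -> vl_meet (h m) (h n) = 0) ->
  (forall n, cmodulus (z n - l) <= h n) -> @uo_cvg _ _ nat_directed z l.
Proof.
move=> h0 h_disj zh u u0.
have /choice[y yP] n : exists s,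
    supremums (range (fun k => vl_meet (h (n + k)%N) u)) s.
  by apply: (@seq_supremum _ _ F_sigma _ u) => k; exact: vl_meetr.
have hy n k : (n <= k)%N -> vl_meet (h k) u <= y n.
  by move=> nk; apply: (yP n).1; exists (k - n)%N; rewrite ?subnKC.
have y0 n : 0 <= y n.
  by apply: le_trans (hy n n (leqnn n)); rewrite vl_meet_ge0.
exists nat_directed, y; split; last first.
  move=> n; exists n => k nk; rewrite subr0 vl_ger0_modulus; last first.
    by rewrite vl_meet_ge0// cmodulus_ge0.
  by rewrite (le_trans _ (hy n k nk))// vl_meet_le.
split=> [m n mn|].
  apply: (yP n).2 => _ [k _ <-]; apply: hy.
  exact: leq_trans mn (leq_addr _ _).
split=> [_ [n _ <-]//|b b_lb].
pose c := vl_pos b.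
have c_le n : c <= y n by rewrite vl_pos_lub//; apply: b_lb; exists n.
have c_disj k : vl_meet c (h k) = 0.
  apply: (@vl_disjoint_le _ _ _ _ (y k.+1) (h k)); rewrite ?vl_pos_ge0//.
  rewrite vl_meetC; apply: vl_disjoint_sup (yP k.+1) _ _ => //.
  - by move=> _ [m _ <-]; rewrite vl_meet_ge0.
  - move=> _ [m _ <-].
    apply: (@vl_disjoint_le _ _ _ _ (h k) (h (k.+1 + m)%N));
      rewrite ?vl_meet_ge0 ?vl_meetl//.
    apply: h_disj => km; have : (k < k.+1 + m)%N by rewrite leq_addr.
    by rewrite -km ltnn.
have -> : 0 = vl_meet c (y 0%N).
  apply/esym; apply: vl_disjoint_sup (yP 0%N) _ _; rewrite ?vl_pos_ge0//.
  - by move=> _ [m _ <-]; rewrite vl_meet_ge0.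
  - move=> _ [m _ <-].
    by apply: (@vl_disjoint_le _ _ _ _ c (h m));
      rewrite ?vl_meet_ge0 ?vl_pos_ge0 ?vl_meetl.
by rewrite vl_meet_idPl ?vl_le_pos.
Qed.

End BanachLattice.

(** * Order bounded disjoint sequences when order continuity fails *)

Section OrderContinuity.
Variables (R : realType) (F : normedLatticeType R).
Hypothesis F_sigma : sigma_dedekind_complete F.
Hypothesis E_banach : complexification_complete F.
Implicit Types (x y z u w p : F).

(** Here [p] is the component of [x] in the band generated by [w]. Passing from [k] to [k.+1]
    absorbs [vl_meet (x - p) w], so [p] minus this meet is still an upper bound. Hence [x - p] is
    disjoint from [w], then from its multiples and from their truncations' supremum [p]. *)
Lemma principal_component x w : 0 <= x -> 0 <= w ->
  exists p, [/\ supremums (range (fun k : nat => vl_meet x (k%:R *: w))) p,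
    0 <= p, p <= x, vl_meet x w <= p & vl_meet (x - p) p = 0].
Proof.
move=> x0 w0; have [|p pP] := @seq_supremum _ _ F_sigma
  (fun k : nat => vl_meet x (k%:R *: w)) x; first by move=> k; exact: vl_meetl.
have kp k : vl_meet x (k%:R *: w) <= p by apply: pP.1; exists k.
have kw0 k : 0 <= k%:R *: w by rewrite vl_scale_ge0.
have p0 : 0 <= p by rewrite (le_trans _ (kp 0%N))// vl_meet_ge0.
have px : p <= x by apply: pP.2 => _ [k _ <-]; exact: vl_meetl.
have xp0 : 0 <= x - p by rewrite vl_subr_ge0.
exists p; split=> //; first by have := kp 1%N; rewrite scale1r.
have xpw : vl_meet (x - p) w = 0.
  apply/le_anti; rewrite vl_meet_ge0// andbT.
  suff : p <= p - vl_meet (x - p) w.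
    by rewrite -vl_subr_ge0 addrAC subrr sub0r -[_ <= 0]vl_leN2 oppr0.
  apply: pP.2 => _ [k _ <-]; rewrite vl_leBrDr; apply: le_trans (kp k.+1).
  rewrite vl_lexI; apply/andP; split.
    by rewrite -[leRHS](subrKC p); apply: vl_leD; [exact: kp|exact: vl_meetl].
  rewrite -addn1 natrD scalerDl scale1r.
  by apply: vl_leD; exact: vl_meetr.
apply: vl_disjoint_sup pP _ _ => //.
  by move=> _ [k _ <-]; rewrite vl_meet_ge0.
move=> _ [k _ <-].
apply: (@vl_disjoint_le _ _ _ _ (x - p) (k%:R *: w));
  rewrite ?vl_meetr ?vl_meet_ge0//.
by rewrite vl_meetC vl_disjointZ// vl_meetC.
Qed.

(** This says, without bands, that [x] lies below [y] where [y] exceeds [x]: bound [x] by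
    [y + vl_pos (x - y)], whose second term is disjoint from every multiple of [vl_pos (y - x)]. *)
Lemma meet_scale_pos_le x y (k : R) : 0 <= x -> 0 <= y -> 0 <= k ->
  vl_meet x (k *: vl_pos (y - x)) <= y.
Proof.
move=> x0 y0 k0; have kw0 : 0 <= k *: vl_pos (y - x).
  by rewrite vl_scale_ge0 ?vl_pos_ge0.
apply: (@le_trans _ _ (vl_meet (y + vl_pos (x - y)) (k *: vl_pos (y - x)))).
  by rewrite vl_meet_le// addrC -vl_leBlDr vl_le_pos.
apply: le_trans (vl_meetD_le _ _ _) _ => //; first exact: vl_pos_ge0.
rewrite (vl_meetC (vl_pos _)) vl_disjointZ ?vl_pos_ge0 ?vl_pos_disjoint//.
by rewrite addr0 vl_meetl.
Qed.

Lemma order_bounded_disjoint_seq : ~ order_continuous_norm F ->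
  exists (x : F) (d : nat -> F) (eta : R), [/\ 0 < eta,
    forall n, 0 <= d n <= x, forall m n, m <> n -> vl_meet (d m) (d n) = 0 &
    forall n, eta <= lnorm (d n)].
Proof.
move=> /existsNP[I /existsNP[v /not_implyP[v_to0 v_ncvg]]].
have [eta [a [eta0 a_mono gap]]] :=
  decreasing_net_gap F_sigma E_banach v_to0 v_ncvg.
(* The extracted sequence may have a nonzero infimum [y]; subtracting it gives a sequence [r] that
   decreases to 0. *)
have [|y [y_lb y_glb]] := @seq_infimum _ _ F_sigma (fun n => v (a n)) 0.
  by move=> n; apply: v_to0.2.1; exists (a n).
pose r n := v (a n) - y.
have r0 n : 0 <= r n by rewrite vl_subr_ge0; apply: y_lb; exists n.
have r_dec m n : (m <= n)%N -> r n <= r m.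
  by move=> mn; rewrite vl_leD2rE; apply: v_to0.1; exact: a_mono.
have r_inf (b : F) : (forall n, b <= r n) -> b <= 0.
  move=> br; rewrite -(vl_leD2rE y) add0r; apply: y_glb => _ [n _ <-].
  by rewrite -vl_leBrDr; exact: br.
have r_eta n : eta <= lnorm (r n).
  apply: le_trans (gap n) _; rewrite lnorm_le ?vl_subr_ge0//.
    by apply: v_to0.1; exact: a_mono.
  by rewrite vl_leD2lE vl_leN2; apply: y_lb; exists n.+1.
pose x := r 0%N; have x0 : 0 <= x by exact: r0.
have nx0 : 0 < lnorm x by exact: lt_le_trans (r_eta 0%N).
(* With this choice [delta *: x] has norm [eta / 2], half of the lower bound on the norms of [r]. *)
pose delta := eta / (2 * lnorm x).
have delta0 : 0 < delta by rewrite divr_gt0// mulr_gt0.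
have dx0 : 0 <= delta *: x by rewrite vl_scale_ge0// ltW.
pose w n := vl_pos (r n - delta *: x).
have w0 n : 0 <= w n by exact: vl_pos_ge0.
have /choice[p pP] n := principal_component x0 (w0 n).
have p_dec m n : (m <= n)%N -> p n <= p m.
  move=> mn; have [[_ lub] _ _ _ _] := pP n; have [[ub _] _ _ _ _] := pP m.
  apply: lub => _ [k _ <-].
  apply: (@le_trans _ _ (vl_meet x (k%:R *: w m))); last by apply: ub; exists k.
  by rewrite vl_meet_le// vl_scale_le// vl_pos_le// vl_leD2rE r_dec.
(* On the band of [w n] the vector [r n] exceeds [delta *: x]. This bound forces the components
   [p n] to decrease to 0. *)
have p_le n : delta *: p n <= r n.
  rewrite -[r n](scalerKV (lt0r_neq0 delta0)) vl_scale_le ?(ltW delta0)//.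
  have [[_ lub] _ _ _ _] := pP n; apply: lub => _ [k _ <-].
  rewrite -[vl_meet _ _](scalerK (lt0r_neq0 delta0)).
  rewrite vl_scale_le ?invr_ge0 ?(ltW delta0)// vl_scale_meet// scalerA.
  by rewrite meet_scale_pos_le// mulr_ge0// ltW.
have p_eta n : eta / 2 <= lnorm (p n).
  (* Since [w n <= r n <= r 0 = x], the truncation of [w n] by [x] is [w n] itself, and it lies
     below [p n]. *)
  have rp : r n <= p n + delta *: x.
    rewrite -vl_leBlDr; apply: le_trans (vl_le_pos _) _.
    have [_ _ _ + _] := pP n; rewrite vl_meetC vl_meet_idPl//.
    by rewrite vl_pos_lub// (le_trans (vl_lerBl _ dx0))// r_dec.
  have := le_trans (r_eta n) (le_trans (lnorm_le (r0 n) rp) (lnormD _ _)).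
  rewrite lnormZ gtr0_norm// /delta invfM mulrA mulfVK ?lt0r_neq0//.
  by move: (lnorm _) => *; lra.
have p_to0 : @decreases_to0 _ _ nat_directed p.
  split=> //; split=> [_ [n _ <-]|b b_lb]; first by have [_] := pP n.
  rewrite -[b](scalerK (lt0r_neq0 delta0)) -(scaler0 _ delta^-1).
  rewrite vl_scale_le ?invr_ge0 ?(ltW delta0)//.
  apply: r_inf => n; apply: le_trans (p_le n).
  by rewrite vl_scale_le ?(ltW delta0)//; apply: b_lb; exists n.
have p_ncvg : ~ (fun n => lnorm (p n)) @ tails nat_directed --> (0 : R).
  move=> /(tails_cvg0P (fun n : nat_directed => lnorm_ge0 (p n)))/(_ (eta / 4)).
  move=> []; [by rewrite divr_gt0|move=> N NP].
  by move: (NP N (leqnn N)) (p_eta N); lra.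
(* A second extraction, now among the components, yields differences that are disjoint as well as
   bounded away from 0. *)
have [theta [c [theta0 c_mono gapp]]] :=
  decreasing_net_gap F_sigma E_banach p_to0 p_ncvg.
exists x, (fun n => p (c n) - p (c n.+1)), theta.
have p0 n : 0 <= p n by have [] := pP n.
have px n : p n <= x by have [] := pP n.
have d0 n : 0 <= p (c n) - p (c n.+1).
  by rewrite vl_subr_ge0; apply: p_dec; exact: c_mono.
split=> // [n|m n mn].
  by rewrite d0 (le_trans (vl_lerBl _ (p0 _)))// px.
wlog ltmn : m n mn / (m < n)%N.
  move=> W; have [lt_mn|le_nm] := ltnP m n; first exact: W.
  rewrite vl_meetC W//; first exact/nesym.
  by rewrite ltn_neqAle le_nm andbT; apply/eqP/nesym.
(* For [m < n] the earlier difference lies below [x - p (c m.+1)] and the later one below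
   [p (c m.+1)]. *)
have [_ _ _ _ disj] := pP (c m.+1).
apply: (vl_disjoint_le _ _ _ _ disj) => //.
  by rewrite vl_leD2rE px.
rewrite (le_trans (vl_lerBl _ (p0 _)))// p_dec//; exact: c_mono.
Qed.

End OrderContinuity.

(** * Consequences of the sequential Brezis-Lieb condition *)

Section SigmaBrezisLieb.
Variables (R : realType) (F : normedLatticeType R).
Hypothesis F_sigma : sigma_dedekind_complete F.
Hypothesis E_banach : complexification_complete F.

Lemma sigma_brezis_lieb_order_continuous :
  sigma_brezis_lieb_space F -> order_continuous_norm F.
Proof.
move=> BL; apply: contrapT => /(order_bounded_disjoint_seq F_sigma E_banach).
move=> [x [d [eta [eta0 dx d_disj d_eta]]]].
have d0 n : 0 <= d n by case/andP: (dx n).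
have dlex n : d n <= x by case/andP: (dx n).
have xd0 n : 0 <= x - d n by rewrite vl_subr_ge0.
(* Intermediate value theorem: at [k = 0] the norm is at most that of [x], and at
   [M = lnorm x / eta] the term [k *: d n.*2.+1] alone already has norm at least [lnorm x].
   Continuity holds because [f] is Lipschitz. *)
have /choice[k kP] n : exists k : R, 0 <= k /\
    lnorm (x - d n.*2 + k *: d n.*2.+1) = lnorm x.
  pose f (k : R) := lnorm (x - d n.*2 + k *: d n.*2.+1).
  pose M := lnorm x / eta.
  have M0 : 0 <= M by rewrite divr_ge0 ?lnorm_ge0// ltW.
  have f_cont : continuous f.
    move=> a; apply/cvgrPdist_le => e e0.
    pose l := lnorm (d n.*2.+1); have l0 : 0 <= l by exact: lnorm_ge0.
    have f_lip s t : f s - f t <= `|s - t| * l.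
      rewrite lerBlDr -lnormZ scalerBl; apply: le_trans (lnormD _ _).
      by rewrite [X in _ <= lnorm X]addrCA subrK.
    exists (e / (l + 1)) => /=; first by rewrite divr_gt0// ltr_wpDl.
    move=> b /=; rewrite ltr_pdivlMr ?ltr_wpDl// => ab.
    have := f_lip a b; have := f_lip b a; rewrite (distrC b) => ? ?.
    have : `|a - b| * l <= e.
      by rewrite (le_trans _ (ltW ab))// ler_wpM2l// lerDl.
    by rewrite ler_norml => ?; apply/andP; split; lra.
  have [|k] := @IVT _ f 0 M (lnorm x) M0 (continuous_subspaceT f_cont).
    rewrite ge_min le_max {1}/f scale0r addr0 lnorm_le ?vl_lerBl//=.
    apply/orP; right; apply: (@le_trans _ _ (lnorm (M *: d n.*2.+1))).
      rewrite lnormZ ger0_norm// mulrAC ler_pdivlMr//.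
      by rewrite ler_wpM2l ?lnorm_ge0.
    by rewrite lnorm_le ?vl_scale_ge0// addrC vl_lerDl.
  by rewrite in_itv/= => /andP[k0 _] fk; exists k.
pose y n := x - d n.*2 + k n *: d n.*2.+1.
pose h n := d n.*2 + k n *: d n.*2.+1.
have kd0 n : 0 <= k n *: d n.*2.+1 by rewrite vl_scale_ge0//; case: (kP n).
have yx n : y n - x = k n *: d n.*2.+1 - d n.*2.
  by rewrite /y addrAC [x - _ - x]addrAC subrr add0r addrC.
have d_kd n : vl_meet (d n.*2) (k n *: d n.*2.+1) = 0.
  rewrite vl_meetC vl_disjointZ//; first by case: (kP n).
  by rewrite d_disj// => /eqP; rewrite -{2}[n.*2]addn0 -addn1 eqn_add2l.
have : (fun n => cnorm (of_real (y n) - of_real x)) @ \oo --> (0 : R).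
  apply: BL.
    rewrite cnorm_of_real//; under eq_fun do rewrite cnorm_of_real// (kP _).2.
    exact: cvg_cst.
  apply: (@disjoint_uo_cvg _ _ F_sigma _ _ h).
  - by move=> n; rewrite vl_addr_ge0.
  - move=> m n mn; have [km _] := kP m; have [kn _] := kP n.
    (* Halving recovers [n] from both indices used in [h n], so distinct terms of [h] involve
       distinct indices of [d]. *)
    have dd i j : half i = m -> half j = n -> vl_meet (d i) (d j) = 0.
      by move=> im jn; apply: d_disj => ij; apply: mn; rewrite -im -jn ij.
    have dh i : half i = m -> vl_meet (d i) (h n) = 0.
      move=> im; rewrite vl_meetC vl_disjointD//.
        by rewrite vl_meetC dd// doubleK.
      by rewrite vl_disjointZ// vl_meetC dd//= uphalf_double.
    rewrite vl_disjointD ?vl_addr_ge0 ?dh ?doubleK//.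
    by rewrite vl_disjointZ ?vl_addr_ge0 ?dh//= uphalf_double.
  - move=> n; rewrite of_realB cmodulus_of_real// yx vl_modulus_leP opprB.
    have dkd := vl_addr_ge0 (d0 n.*2) (kd0 n).
    rewrite (le_trans (vl_lerBl _ (d0 _))) ?(le_trans (vl_lerBl _ (kd0 _)))//.
      by rewrite vl_lerDl.
    by rewrite /h addrC vl_lerDl.
move=> /cvgrPdist_lt/(_ eta eta0)[N _ /(_ N (leqnn N))] /=.
rewrite sub0r normrN ger0_norm ?cnorm_ge0// of_realB cnorm_of_real// yx.
rewrite ltNge => /negP; apply; apply: le_trans (d_eta N.*2) _.
rewrite -(lnorm_modulus (_ - _)) lnorm_le//.
(* By disjointness no cancellation occurs, so [modulus (y N - x)] dominates [d N.*2], whose norm is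
   at least [eta]. *)
have dE : vl_pos (d N.*2 - k N *: d N.*2.+1) = d N.*2.
  by rewrite vl_posB d_kd subr0.
rewrite -{1}dE.
by rewrite vl_pos_lub ?vl_modulus_ge0// -vl_modulusN opprB vl_le_modulus.
Qed.

(** If the property failed, the norms of [u0 + u n], which are at least that of [u0], would converge
    to it. Disjointness makes [u0 + u n] uo-convergent to [u0], yet the distance is always 1. *)
Lemma sigma_brezis_lieb_has_property :
  sigma_brezis_lieb_space F -> brezis_lieb_property F.
Proof.
move=> BL u u0 u0_ge0 u_ge0 u_disj u_norm.
rewrite ltNge; apply/negP => /limn_esup_le_cvg ulim.
have : (fun n => cnorm (of_real (u0 + u n) - of_real u0)) @ \oo --> (0 : R).
  apply: BL.
    apply: (fine_cvg (ulim _)) => n; rewrite lee_fin !cnorm_of_real//.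
    by rewrite lnorm_le// vl_lerDl.
  apply: (@disjoint_uo_cvg _ _ F_sigma _ _ u) => // n.
  by rewrite of_realB addrAC subrr add0r cmodulus_of_real// vl_ger0_modulus.
move=> /cvgrPdist_lt/(_ 1 ltr01)[N _ /(_ N (leqnn N))] /=.
by rewrite sub0r normrN of_realB addrAC subrr add0r u_norm normr1 ltxx.
Qed.

End SigmaBrezisLieb.

(** * From the Brezis-Lieb property and order continuity to nets *)

Section BrezisLiebProperty.
Variables (R : realType) (F : normedLatticeType R).
Hypothesis F_sigma : sigma_dedekind_complete F.
Hypothesis E_banach : complexification_complete F.
Implicit Types (x y z u W : F) (w T : nat -> F).

Local Notation q := (2^-1 : R).

Lemma half_expn_small (C e : R) : 0 <= C -> 0 < e ->
  exists N, forall n, (N <= n)%N -> q ^+ n * C <= e.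
Proof.
move=> C0 e0; have C10 : 0 < C + 1 by rewrite ltr_wpDl.
have q1 : `|q| < 1 by rewrite ger0_norm ?invr_ge0// invf_lt1// ltr1n.
have eC : 0 < e / (C + 1) by rewrite divr_gt0.
have [N _ NP] := (cvgrPdist_le _ _).1 (cvg_expr q1) _ eC.
exists N => n /NP /=; rewrite sub0r normrN ger0_norm ?exprn_ge0 ?invr_ge0//.
rewrite ler_pdivlMr//; apply: le_trans.
by rewrite ler_wpM2l ?exprn_ge0 ?invr_ge0// lerDl.
Qed.

(** The bound is the norm limit of the increasing partial sums of the geometrically weighted
    series. *)
Lemma weighted_upper_bound w (C : R) : (forall n, 0 <= w n) ->
  (forall n, lnorm (w n) <= C) -> exists W, forall n, q ^+ n *: w n <= W.
Proof.
move=> w0 wC; have q0 n : 0 <= q ^+ n by rewrite exprn_ge0 ?invr_ge0.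
have C0 : 0 <= C by exact: le_trans (lnorm_ge0 _) (wC 0%N).
pose S n := \sum_(i < n) q ^+ i *: w i.
have SS n : S n.+1 = S n + q ^+ n *: w n by rewrite /S big_ord_recr.
have S_mono : {homo S : m n / (m <= n)%N >-> m <= n}.
  apply: homo_leq => [x|x y z|n]; [exact: lexx|exact: le_trans|].
  by rewrite SS vl_lerDl// vl_scale_ge0.
have S_cauchy m k :
    lnorm (S (m + k)%N - S m) <= 2 * C * (q ^+ m - q ^+ (m + k)).
  elim: k => [|k IH]; first by rewrite addn0 !subrr lnorm0 mulr0.
  rewrite addnS SS addrAC; apply: le_trans (lnormD _ _) _.
  rewrite lnormZ ger0_norm// exprS.
  have : q ^+ (m + k) * lnorm (w (m + k)%N) <= q ^+ (m + k) * C.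
    by rewrite ler_wpM2l.
  by move: IH; move: (lnorm _) (q ^+ (m + k) * lnorm _) => *; lra.
have [l lP] : exists l, forall e, 0 < e -> exists N, forall n, (N <= n)%N ->
    lnorm (S n - l) <= e.
  apply: (lnorm_complete F_sigma E_banach) => e e0.
  (* Each of the two distances to [S N] is at most [2 * (q ^+ N * C)]; the factor 5 instead of 4
     makes the final inequality strict. *)
  have [N NP] := half_expn_small (mulr_ge0 (ler0n _ 5) C0) e0.
  have near_SN k : (N <= k)%N -> lnorm (S k - S N) <= 2 * (q ^+ N * C).
    move=> /subnKC <-; apply: le_trans (S_cauchy N _) _.
    rewrite mulrBr [q ^+ N * C]mulrC mulrA gerBl.
    by rewrite !mulr_ge0.
  exists N => m n /near_SN mN /near_SN nN.
  have -> : S m - S n = (S m - S N) - (S n - S N) by rewrite opprB addrA subrK.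
  have qC0 : 0 <= q ^+ N * C by rewrite mulr_ge0.
  move: (NP N (leqnn N)) (lnormB (S m - S N) (S n - S N)) mN nN.
  rewrite mulrCA; move: qC0; move: (q ^+ N * C) (lnorm _) (lnorm _) (lnorm _).
  by move=> *; lra.
exists l => n; apply: (@le_trans _ _ (S n.+1)).
  rewrite SS addrC vl_lerDl//; have := S_mono 0%N n (leq0n _).
  by rewrite {1}/S big_ord0.
rewrite -[_ <= _](vl_leD2rE (- l)) subrr; apply: pos_small_le0 => e e0.
have [N NP] := lP e e0; apply: le_trans (NP _ (leq_maxl N n.+1)).
apply: le_trans (lnorm_pos_le _).
by rewrite lnorm_le ?vl_pos_ge0// vl_pos_le// vl_leD2rE S_mono// leq_maxr.
Qed.

(* Subtracting [4 ^+ n *: T n] separates [d n] from the earlier terms of [w],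
   subtracting [q ^+ n *: W] from the later ones. *)
Lemma disjointification w T W : (forall n, 0 <= w n) -> (forall n, 0 <= T n) ->
  (forall m n, (m < n)%N -> w m <= T n) -> (forall n, q ^+ n *: w n <= W) ->
  let d n := vl_pos (w n - (4 ^+ n *: T n + q ^+ n *: W)) in
  forall m n, m <> n -> vl_meet (d m) (d n) = 0.
Proof.
move=> w0 T0 wT wW d m n mn.
wlog ltmn : m n mn / (m < n)%N.
  move=> H; have [lt_mn|le_nm] := ltnP m n; first exact: H.
  rewrite vl_meetC H//; first exact/nesym.
  by rewrite ltn_neqAle le_nm andbT; apply/eqP/nesym.
have q0 k : 0 < q ^+ k by rewrite exprn_gt0// invr_gt0.
have f0 : 0 < 4 ^+ n :> R by rewrite exprn_gt0.
have W0 : 0 <= W by apply: le_trans (wW 0%N); rewrite expr0 scale1r.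
have fi0 : 0 < (4 ^+ n)^-1 :> R by rewrite invr_gt0.
(* For [m < n], [d m] and [d n] are dominated by multiples of the two opposite positive parts of
   [w n - 4 ^+ n *: w m]. *)
apply: (@vl_disjoint_le _ _ _ _ ((4 ^+ n)^-1 *: vl_pos (4 ^+ n *: w m - w n))
   (vl_pos (w n - 4 ^+ n *: w m))); rewrite ?vl_pos_ge0//; last first.
- by rewrite vl_disjointZ ?vl_pos_ge0 ?vl_pos_disjoint// ltW.
- apply: vl_pos_le; rewrite vl_leD2lE vl_leN2.
  apply: (@le_trans _ _ (4 ^+ n *: T n)).
    by rewrite vl_scale_le ?(ltW f0)// wT.
  by rewrite vl_lerDl// vl_scale_ge0 ?(ltW (q0 _)).
- apply: vl_pos_lub; last by rewrite vl_scale_ge0 ?vl_pos_ge0// ltW.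
  apply: (@le_trans _ _ ((4 ^+ n)^-1 *: (4 ^+ n *: w m - w n))); last first.
    by rewrite vl_scale_le ?(ltW fi0)// vl_le_pos.
  rewrite scalerBr scalerK ?lt0r_neq0// vl_leD2lE vl_leN2.
  apply: (@le_trans _ _ (q ^+ m *: W)); last first.
    by rewrite addrC vl_lerDl// vl_scale_ge0// ltW.
  apply: (@le_trans _ _ (q ^+ m *: (q ^+ n *: w n))); last first.
    by rewrite vl_scale_le ?(ltW (q0 _)).
  rewrite scalerA vl_scale_lel//.
  (* One factor [q ^+ n] is used up by the bound [W]; the other is at most [q ^+ m]. *)
  have -> : (4 ^+ n)^-1 = q ^+ n * q ^+ n :> R.
    by rewrite -exprMn -invfM -exprVn -natrM.
  rewrite ler_wpM2r ?(ltW (q0 _))// ler_wiXn2l ?invr_ge0 ?invf_le1 ?ler1n//.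
  exact: ltnW.
Qed.


Lemma brezis_lieb_property_net_cvg (I : directedType) (w : I -> F) u0 :
  brezis_lieb_property F -> 0 <= u0 -> (forall i, 0 <= w i) ->
  (forall u e, 0 <= u -> 0 < e -> exists i0, forall i, dir_le i0 i ->
     lnorm (vl_meet (w i) u) <= e) ->
  (forall e, 0 < e -> exists i0, forall i, dir_le i0 i ->
     lnorm (u0 + w i) <= lnorm u0 + e) ->
  forall e, 0 < e -> exists i0, forall i, dir_le i0 i -> lnorm (w i) <= e.
Proof.
move=> BL u0_ge0 w0 w_un w_norm e e0; apply: contrapT => /forallNP w_big.
have q0 n : 0 < q ^+ n by rewrite exprn_gt0// invr_gt0.
(* A pair holds a precision and a vector from which the chosen term must be nearly disjoint. The
   implication makes the choice total; [i0] serves as index for vectors that are not positive. *)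
have /choice[g gP] (p : nat * F) : exists i, 0 <= p.2 ->
    [/\ lnorm (vl_meet (w i) p.2) <= q ^+ p.1,
      lnorm (u0 + w i) <= lnorm u0 + q ^+ p.1 & e <= lnorm (w i)].
  case: p => n u /=; have [i0 _] := w_norm _ (q0 0%N).
  have [u_ge0|nu0] := pselect (0 <= u); last by exists i0 => /nu0.
  have [i1 i1P] := w_un u _ u_ge0 (q0 n); have [i2 i2P] := w_norm _ (q0 n).
  have [i3 [i13 i23]] := dir_ub i1 i2.
  have /existsNP[i /not_implyP[i3i /negP]] := w_big i3; rewrite -ltNge => ei.
  exists i => _; split; last exact: ltW.
    by apply: i1P; exact: dir_trans i3i.
  by apply: i2P; exact: dir_trans i3i.
(* [T n] is the sum of the terms chosen before stage [n], so it dominates each of them. *)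
pose T := fix T n := if n is m.+1 then T m + w (g (m, 4 ^+ m *: T m)) else 0.
pose v n := w (g (n, 4 ^+ n *: T n)).
have v0 n : 0 <= v n by exact: w0.
have TS n : T n.+1 = T n + v n by [].
have T0 n : 0 <= T n by elim: n => //= n IH; rewrite vl_addr_ge0.
have vT m n : (m < n)%N -> v m <= T n.
  elim: n => // n IH; rewrite ltnS leq_eqVlt TS => /predU1P[->|/IH vm].
    by rewrite addrC vl_lerDl.
  by rewrite (le_trans vm)// vl_lerDl.
have fT0 n : 0 <= 4 ^+ n *: T n by rewrite vl_scale_ge0// exprn_ge0.
have vP n := gP (n, 4 ^+ n *: T n) (fT0 n).
have [W WP] : exists W, forall n, q ^+ n *: v n <= W.
  apply: (@weighted_upper_bound _ (lnorm u0 + 1)) => // n.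
  have [_ + _] := vP n; rewrite -/(v n) /= => vn.
  apply: (@le_trans _ _ (lnorm (u0 + v n))).
    by rewrite lnorm_le// addrC vl_lerDl.
  by rewrite (le_trans vn)// lerD2l exprn_ile1 ?invr_ge0 ?invf_le1 ?ler1n.
have W0 : 0 <= W by apply: le_trans (WP 0%N); rewrite expr0 scale1r.
have qW0 n : 0 <= q ^+ n *: W by rewrite vl_scale_ge0// ltW.
have := disjointification v0 T0 vT WP; set d := fun n => vl_pos _ => d_disj.
have d0 n : 0 <= d n by exact: vl_pos_ge0.
have dv n : d n <= v n.
  by rewrite vl_pos_lub// vl_lerBl// vl_addr_ge0.
(* What [d n] loses is a truncation of [v n]; its part at [4 ^+ n *: T n] is small by the choice of
   [v n], and its part at [q ^+ n *: W] by the weight. *)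
have d_near n : lnorm (v n) <= lnorm (d n) + q ^+ n * (1 + lnorm W).
  rewrite mulrDr mulr1.
  have -> : v n = d n + vl_meet (v n) (4 ^+ n *: T n + q ^+ n *: W).
    by rewrite /d vl_posB subrK.
  apply: le_trans (lnormD _ _) _; rewrite lerD2l.
  apply: (@le_trans _ _ (lnorm (vl_meet (v n) (4 ^+ n *: T n) + q ^+ n *: W))).
    rewrite lnorm_le ?vl_meet_ge0 ?vl_addr_ge0// vl_meetC.
    apply: le_trans (vl_meetD_le _ _ _) _ => //.
    by rewrite vl_meetC vl_leD// vl_meetl.
  apply: le_trans (lnormD _ _) _; rewrite lnormZ gtr0_norm// lerD2r.
  by have [] := vP n.
have e20 : 0 < e / 2 by rewrite divr_gt0.
have [N NP] := half_expn_small (addr_ge0 ler01 (lnorm_ge0 W)) e20.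
(* Past [N] the error is at most [e / 2] while [v] has norm at least [e], so [c] bounds the norms of
   [D] from below. *)
pose D n := d (N + n)%N; pose c := e / 2.
have D0 n : 0 <= D n by exact: d0.
have Dc n : c <= lnorm (D n).
  have := NP (N + n)%N (leq_addr _ _); have := d_near (N + n)%N.
  have [_ _] := vP (N + n)%N; rewrite -/(v _) /= -/(D _) /c.
  by move: (lnorm (v _)) (lnorm (D _)) (q ^+ _ * _) => *; lra.
have lD0 n : 0 < lnorm (D n) by exact: lt_le_trans (Dc n).
pose u n := (lnorm (D n))^-1 *: D n.
have u_ge0 n : 0 <= u n by rewrite vl_scale_ge0// invr_ge0 lnorm_ge0.
have ci0 : 0 < c^-1 by rewrite invr_gt0.
have u_disj m n : m <> n -> vl_meet (u m) (u n) = 0.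
  move=> mn; have mnN : (N + m)%N <> (N + n)%N by move=> /addnI.
  rewrite vl_disjointZ ?invr_ge0 ?lnorm_ge0// vl_meetC.
  by rewrite vl_disjointZ ?invr_ge0 ?lnorm_ge0// d_disj//; exact: nesym.
have u_norm n : cnorm (of_real (u n)) = 1.
  by rewrite cnorm_of_real// lnormZ gtr0_norm ?invr_gt0// mulVf// lt0r_neq0.
have cu0 : 0 <= c^-1 *: u0 by rewrite vl_scale_ge0// ltW.
(* Scaling [u0] by [c^-1] matches the normalization: [u n <= c^-1 *: D n], so [c^-1 *: u0 + u n]
   lies below [c^-1 *: (u0 + D n)], whose norm exceeds that of [c^-1 *: u0] by at most
   [c^-1 * q ^+ (N + n)]. *)
have := BL _ _ cu0 u_ge0 u_disj u_norm.
suff ulim : (fun n => (cnorm (of_real (c^-1 *: u0 + u n)))%:E) @ \oo -->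
    (cnorm (of_real (c^-1 *: u0)))%:E.
  by have [_ ->] := cvg_limn_einf_sup ulim; rewrite ltxx.
apply: cvg_EFin; first by near=> n.
apply/cvgrPdist_le => r r0; have [M MP] := half_expn_small (ltW ci0) r0.
exists M => // n /= Mn; rewrite !cnorm_of_real// distrC ger0_norm; last first.
  by rewrite subr_ge0 lnorm_le// vl_lerDl.
rewrite lerBlDr; apply: (@le_trans _ _ (lnorm (c^-1 *: (u0 + D n)))).
  rewrite lnorm_le ?vl_addr_ge0// scalerDr vl_leD2lE vl_scale_lel//.
  by rewrite lef_pV2 ?posrE ?divr_gt0.
rewrite !lnormZ !(gtr0_norm ci0) [leRHS]addrC.
apply: (@le_trans _ _ (c^-1 * (lnorm u0 + q ^+ (N + n)))).
  rewrite ler_wpM2l ?(ltW ci0)//; have [_ + _] := vP (N + n)%N.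
  apply: le_trans; rewrite lnorm_le ?vl_addr_ge0// vl_leD2lE.
  exact: dv.
rewrite mulrDr lerD2l mulrC; apply: MP; exact: leq_trans (leq_addl _ _).
Unshelve. all: by end_near.
Qed.

Lemma brezis_lieb_property_space :
  brezis_lieb_property F -> order_continuous_norm F -> brezis_lieb_space F.
Proof.
move=> BL OC I x x0 x_norm x_uo.
have un u e : 0 <= u -> 0 < e -> exists i0, forall i, dir_le i0 i ->
    lnorm (vl_meet (cmodulus (x i - x0)) u) <= e.
  move=> u0 e0; have [J [y [y_to0 yP]]] := x_uo u u0.
  have [j0 jP] := (tails_cvgP _ _).1 (OC _ _ y_to0) e e0.
  have [i0 iP] := yP j0; exists i0 => i /iP; rewrite subr0 => /lnorm_modulus_le.
  move=> /le_trans; apply; have := jP j0 (dir_refl _).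
  by rewrite subr0 ger0_norm ?lnorm_ge0.
apply/tails_cvg0P => [i|]; first exact: cnorm_ge0.
apply: (brezis_lieb_property_net_cvg BL (cmodulus_ge0 F_sigma x0)) => //.
  by move=> i; exact: cmodulus_ge0.
(* One quarter pays for the norm of [x i], and two for the meet, which occurs twice in
   [cmodulus_triangle]. *)
move=> e e0; have e40 : 0 < e / 4 by rewrite divr_gt0.
have [i1 i1P] := un _ _ (cmodulus_ge0 F_sigma x0) e40.
have [i2 i2P] := (tails_cvgP _ _).1 x_norm _ e40.
have [i0 [i10 i20]] := dir_ub i1 i2; exists i0 => i i0i.
have := i1P i (dir_trans i10 i0i); have := i2P i (dir_trans i20 i0i).
rewrite ler_norml => /andP[_]; rewrite vl_meetC => xi mi.
have cge0 := cmodulus_ge0 F_sigma.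
have := cmodulus_triangle F_sigma (x i - x0) x0; rewrite [x0 + _]addrC subrK.
move=> /(lnorm_le (vl_addr_ge0 (cge0 x0) (cge0 _))).
move=> /le_trans; apply; apply: le_trans (lnormD _ _) _; rewrite mulr2n.
pose m := vl_meet (cmodulus x0) (cmodulus (x i - x0)); have := lnormD m m.
move: xi mi; rewrite /cnorm; move: (lnorm _) (lnorm _) (lnorm _) (lnorm _).
by move=> *; lra.
Qed.

End BrezisLiebProperty.

(** * Closing the cycle of implications *)

Theorem theorem4 (R : realType) (F : normedLatticeType R)
    (F_uniformly_complete : uniformly_complete F)
    (E_banach : complexification_complete F)
    (E_sigma_dedekind : sigma_dedekind_complete F) :
  (brezis_lieb_space F <-> sigma_brezis_lieb_space F) /\
  (sigma_brezis_lieb_space F <->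
     brezis_lieb_property F /\ order_continuous_norm F).
Proof.
have BS : brezis_lieb_space F -> sigma_brezis_lieb_space F.
  by move=> BL x x0; have := BL nat_directed x x0; rewrite tails_nat.
have SP : sigma_brezis_lieb_space F ->
    brezis_lieb_property F /\ order_continuous_norm F.
  move=> BL; split; first exact: sigma_brezis_lieb_has_property.
  exact: sigma_brezis_lieb_order_continuous.
have PB : brezis_lieb_property F /\ order_continuous_norm F ->
    brezis_lieb_space F.
  by move=> [BL OC]; exact: brezis_lieb_property_space.
by split; split; [exact: BS|move=> /SP/PB|exact: SP|move=> /PB/BS].
Qed.
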